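(* Let $\vdash$ be a logic. (i) If $\vdash$ is consistent, then its left variable inclusion companion $\vdash^{l}$ is not protoalgebraic. (ii) If $\vdash$ is finitary, algebraizable and has a partition function, then $\vdash^{l}$ is truth-equational.
   Context: Fix an algebraic language without constant symbols; $\mathrm{Var}(\varphi)$ is the set of variables of $\varphi$. A logic is a substitution-invariant consequence relation; it is inconsistent if $\Gamma\vdash\varphi$ for all $\Gamma\cup\{\varphi\}$, consistent otherwise; finitary if every consequence follows from a finite subset of premises. The left variable inclusion companion: $\Gamma\vdash^{l}\varphi$ iff there is $\Gamma'\subseteq\Gamma$ with $\bigcup_{\gamma\in\Gamma'}\mathrm{Var}(\gamma)\subseteq\mathrm{Var}(\varphi)$ and $\Gamma'\vdash\varphi$. A matrix $\langle\mathbf{A},F\rangle$ is a model of a logic if $\Gamma\vdash\varphi$ and $h[\Gamma]\subseteq F$ (homomorphism $h$ from the formula algebra) imply $h(\varphi)\in F$; $F$ is then a filter. $\Omega^{\mathbf{A}}F$ is the largest congruence compatible with $F$; $\mathsf{Mod}^{*}(\vdash)$ is the class of models with $\Omega^{\mathbf{A}}F$ the identity; the Suszko congruence is the intersection of $\Omega^{\mathbf{A}}G$ over filters $G\supseteq F$, and $\mathrm{Alg}(\vdash)$ is the class of algebras having a model with identity Suszko congruence. $\vdash$ is protoalgebraic if there is a set of formulas $\Delta(x,y)$ with $\emptyset\vdash\Delta(x,x)$ and $x,\Delta(x,y)\vdash y$. $\vdash$ is equivalential if there is $\Delta(x,y)$ such that for every model $\langle\mathbf{A},F\rangle$ and $a,b$: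 $\langle a,b\rangle\in\Omega^{\mathbf{A}}F$ iff $\Delta^{\mathbf{A}}(a,b)\subseteq F$. $\vdash$ is truth-equational if there is a set of equations $\boldsymbol{\tau}(x)$ such that for every $\langle\mathbf{A},F\rangle\in\mathsf{Mod}^{*}(\vdash)$ and $a\in A$: $a\in F$ iff $\mathbf{A}\models\boldsymbol{\tau}(a)$. $\vdash$ is algebraizable if it is both equivalential and truth-equational. A binary operation $\cdot$ is a partition function on $\mathbf{A}$ if for all $a,b,c$ and basic operations $g$ of arity $n\ge1$: $a\cdot a=a$; $a\cdot(b\cdot c)=(a\cdot b)\cdot c$; $a\cdot(b\cdot c)=a\cdot(c\cdot b)$; $g(a_1,\dots,a_n)\cdot b=g(a_1\cdot b,\dots,a_n\cdot b)$; $b\cdot g(a_1,\dots,a_n)=b\cdot a_1\cdot\ldots\cdot a_n$; $\vdash$ has a partition function if some formula $x\cdot y$ in which both $x,y$ occur satisfies $x\vdash x\cdot y$ and is a partition function on every $\mathbf{A}\in\mathrm{Alg}(\vdash)$. *)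

(* Defs.v *)
From mathcomp Require Import all_boot.
From mathcomp Require Import boolp classical_sets functions cardinality.

Set Implicit Arguments.
Unset Strict Implicit.
Unset Printing Implicit Defensive.

Local Open Scope classical_set_scope.

Record language := Language { symbol : Type; arity : symbol -> nat }.

Record algebra (L : language) := Algebra {
  carrier :> Type;
  carrier_inhabited : inhabited carrier;
  op : forall f : symbol L, ('I_(arity f) -> carrier) -> carrier }.

(* The set of variables is countably infinite, indexed by nat. *)
Inductive form (L : language) : Type :=
| fvar : nat -> form L
| fapp : forall f : symbol L, ('I_(arity f) -> form L) -> form L.

Arguments fvar {L}.

Fixpoint Var (L : language) (phi : form L) : set nat :=
  match phi with
  | fvar n => [set n]
  | fapp f args => \bigcup_(i in [set: 'I_(arity f)]) Var (args i)
  end.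

Definition Fm (L : language) : algebra L :=
  @Algebra L (form L) (inhabits (fvar 0)) (@fapp L).

(* [eval v] is the homomorphism from the formula algebra extending v; by
   [eval_unique] every homomorphism has this form, so quantifying over
   valuations is quantifying over homomorphisms. *)
Fixpoint eval (L : language) (A : algebra L) (v : nat -> A) (phi : form L) : A :=
  match phi with
  | fvar n => v n
  | fapp f args => op (fun i => eval v (args i))
  end.

Definition is_hom (L : language) (A B : algebra L) (h : A -> B) : Prop :=
  forall (f : symbol L) (a : 'I_(arity f) -> A), h (op a) = op (fun i => h (a i)).

Lemma eval_hom (L : language) (A : algebra L) (v : nat -> A) :
  @is_hom L (Fm L) A (eval v).
Proof. by []. Qed.

Lemma eval_unique (L : language) (A : algebra L) (h : form L -> A) :
  @is_hom L (Fm L) A h -> forall phi, h phi = eval (fun n => h (fvar n)) phi.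
Proof.
move=> hh; elim=> [//|f args IH] /=.
by rewrite -[fapp _]/(@op L (Fm L) f args) hh; congr op; apply/funext.
Qed.

(* Substitutions are the endomorphisms of the formula algebra. *)
Definition subst (L : language) (s : nat -> form L) : form L -> form L :=
  @eval L (Fm L) s.

Lemma Var_subst (L : language) (s : nat -> form L) (phi : form L) :
  Var (subst s phi) = \bigcup_(n in Var phi) Var (s n).
Proof.
elim: phi => [n|f args IH] /=; first by rewrite bigcup_set1.
rewrite bigcup_bigcup; apply: eq_bigcupr => i _; exact: IH.
Qed.

Record logic (L : language) := Logic {
  entails :> set (form L) -> form L -> Prop;
  entails_refl : forall (G : set (form L)) phi, G phi -> entails G phi;
  entails_cut : forall (G D : set (form L)) phi,
    (forall psi, D psi -> entails G psi) -> entails D phi -> entails G phi;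
  entails_subst : forall (s : nat -> form L) (G : set (form L)) phi,
    entails G phi -> entails (subst s @` G) (subst s phi) }.

Definition inconsistent (L : language) (l : logic L) : Prop :=
  forall G phi, l G phi.

Definition consistent (L : language) (l : logic L) : Prop := ~ inconsistent l.

Definition finitary (L : language) (l : logic L) : Prop :=
  forall G phi, l G phi ->
    exists G' : set (form L), [/\ G' `<=` G, finite_set G' & l G' phi].

Definition left_entails (L : language) (l : logic L) (G : set (form L))
    (phi : form L) : Prop :=
  exists G' : set (form L),
    [/\ G' `<=` G, \bigcup_(g in G') Var g `<=` Var phi & l G' phi].

Section LeftCompanion.
Context (L : language) (l : logic L).

Lemma left_entails_refl (G : set (form L)) phi : G phi -> left_entails l G phi.
Proof.
move=> Gphi; exists [set phi]; split; first by move=> _ ->.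
  by rewrite bigcup_set1.
exact: entails_refl.
Qed.

Lemma left_entails_cut (G D : set (form L)) phi :
  (forall psi, D psi -> left_entails l G psi) ->
  left_entails l D phi -> left_entails l G phi.
Proof.
move=> GD [D' [D'D VD' D'phi]].
exists [set g | G g /\ Var g `<=` Var phi]; split; first by move=> g [].
  by move=> n [g [_ /[apply]]].
apply: (entails_cut _ D'phi) => psi D'psi.
have [G' [G'G VG' G'psi]] := GD _ (D'D _ D'psi).
apply: (entails_cut _ G'psi) => g G'g; apply: entails_refl; split; first exact: G'G.
by move=> n gn; apply: VD'; exists psi => //; apply: VG'; exists g.
Qed.

Lemma left_entails_subst (s : nat -> form L) (G : set (form L)) phi :
  left_entails l G phi -> left_entails l (subst s @` G) (subst s phi).
Proof.
move=> [G' [G'G VG' G'phi]]; exists (subst s @` G'); split.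
- exact: image_subset.
- move=> n [_ [g G'g <-]]; rewrite !Var_subst => -[m gm sn].
  by exists m => //; apply: VG'; exists g.
- exact: entails_subst.
Qed.

Definition left_companion : logic L :=
  Logic left_entails_refl left_entails_cut left_entails_subst.

End LeftCompanion.

Record congruence (L : language) (A : algebra L) (R : A -> A -> Prop) : Prop :=
  Congruence {
    cong_refl : forall a, R a a;
    cong_sym : forall a b, R a b -> R b a;
    cong_trans : forall a b c, R a b -> R b c -> R a c;
    cong_op : forall (f : symbol L) (a b : 'I_(arity f) -> A),
      (forall i, R (a i) (b i)) -> R (op a) (op b) }.

Definition compatible (L : language) (A : algebra L) (F : set A)
    (R : A -> A -> Prop) : Prop :=
  forall a b, R a b -> F a -> F b.

(* The Leibniz congruence, as the union of all congruences compatible with F;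
   [leibniz_congruence], [leibniz_compatible] and [leibniz_largest] show that
   this union is the largest congruence compatible with F. *)
Definition leibniz (L : language) (A : algebra L) (F : set A) (a b : A) : Prop :=
  exists R : A -> A -> Prop, [/\ congruence R, compatible F R & R a b].

Section Leibniz.
Context (L : language) (A : algebra L) (F : set A).

Lemma leibniz_largest (R : A -> A -> Prop) :
  congruence R -> compatible F R -> forall a b, R a b -> leibniz F a b.
Proof. by move=> cR FR a b Rab; exists R. Qed.

Lemma leibniz_compatible : compatible F (leibniz F).
Proof. by move=> a b [R [_ FR Rab]]; exact: FR. Qed.

Inductive leibniz_chain : A -> A -> Prop :=
| leibniz_chain0 a : leibniz_chain a a
| leibniz_chainS a b c :
    leibniz F a b -> leibniz_chain b c -> leibniz_chain a c.

Let chain_trans a b c :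
  leibniz_chain a b -> leibniz_chain b c -> leibniz_chain a c.
Proof.
elim=> [//|x y z xy _ IH] zc.
by apply: (leibniz_chainS xy); exact: IH.
Qed.

Let leibniz_sym a b : leibniz F a b -> leibniz F b a.
Proof. by move=> [R [cR FR Rab]]; exists R; split=> //; exact: cong_sym. Qed.

Let chain_sym a b : leibniz_chain a b -> leibniz_chain b a.
Proof.
elim=> [x|x y z xy _ IH]; first exact: leibniz_chain0.
apply: (chain_trans IH); apply: leibniz_chainS (leibniz_chain0 _).
exact: leibniz_sym.
Qed.

Let chain_compatible : compatible F leibniz_chain.
Proof.
move=> a b; elim=> [//|x y z xy _ IH] Fx.
by apply: IH; exact: leibniz_compatible xy Fx.
Qed.

Let chain_op1 (f : symbol L) (k : 'I_(arity f)) (a : 'I_(arity f) -> A) (x y : A) :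
  leibniz_chain x y ->
  leibniz_chain (op (fun i => if i == k then x else a i))
                (op (fun i => if i == k then y else a i)).
Proof.
elim=> [z|u v w [R [cR FR Ruv]] _ IH]; first exact: leibniz_chain0.
apply: leibniz_chainS IH; exists R; split=> //.
by apply: (cong_op cR) => i; case: eqP => // _; exact: cong_refl.
Qed.

Let chain_op (f : symbol L) (a b : 'I_(arity f) -> A) :
  (forall i, leibniz_chain (a i) (b i)) -> leibniz_chain (op a) (op b).
Proof.
move=> ab.
have step m : m <= arity f ->
    leibniz_chain (op a) (op (fun i => if i < m then b i else a i)).
  elim: m => [_|m IH mf]; first exact: leibniz_chain0.
  apply: chain_trans (IH (ltnW mf)) _.
  have := chain_op1 (Ordinal mf) (fun i => if i < m then b i else a i)
    (ab (Ordinal mf)).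
  congr leibniz_chain; congr op; apply/funext => i; rewrite -val_eqE /= ?ltnS.
    by case: ltngtP => // im; congr a; apply: val_inj.
  by case: ltngtP => // im; congr b; apply: val_inj.
have := step _ (leqnn _); congr leibniz_chain; congr op.
by apply/funext => i; rewrite ltn_ord.
Qed.

Lemma leibniz_congruence : congruence (leibniz F).
Proof.
have cC : congruence leibniz_chain.
  split; [exact: leibniz_chain0|exact: chain_sym|exact: chain_trans|].
  exact: chain_op.
have toC a b : leibniz F a b -> leibniz_chain a b.
  by move=> ab; exact: leibniz_chainS ab (leibniz_chain0 _).
have ofC := leibniz_largest cC chain_compatible.
split.
- by move=> a; apply: ofC; exact: cong_refl.
- exact: leibniz_sym.
- by move=> a b c /toC ab /toC bc; apply: ofC; exact: chain_trans ab bc.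
- by move=> f a b ab; apply: ofC; apply: chain_op => i; exact: toC.
Qed.

End Leibniz.

Section ModelClasses.
Context (L : language) (l : logic L).

Definition model (A : algebra L) (F : set A) : Prop :=
  forall (G : set (form L)) (phi : form L), l G phi ->
  forall v : nat -> A, (forall g, G g -> F (eval v g)) -> F (eval v phi).

Definition reduced_model (A : algebra L) (F : set A) : Prop :=
  model F /\ forall a b : A, leibniz F a b <-> a = b.

Definition suszko (A : algebra L) (F : set A) (a b : A) : Prop :=
  forall H : set A, model H -> F `<=` H -> leibniz H a b.

Definition Alg (A : algebra L) : Prop :=
  exists F : set A, model F /\ forall a b : A, suszko F a b <-> a = b.

End ModelClasses.

(* In phi(x) and phi(x, y) the variable x is 0 and y is 1. *)
Definition env1 (T : Type) (a : T) : nat -> T := fun=> a.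

Definition env2 (T : Type) (a b : T) : nat -> T :=
  fun n => if n is 0 then a else b.

Definition term2 (L : language) (A : algebra L) (phi : form L) (a b : A) : A :=
  eval (env2 a b) phi.

Definition protoalgebraic (L : language) (l : logic L) : Prop :=
  let x := fvar 0 in let y := fvar 1 in
  exists D : set (form L),
    [/\ forall d, D d -> Var d `<=` [set 0; 1],
        forall d, D d -> l set0 (subst (env2 x x) d) &
        l (x |` D) y].

Definition equivalential (L : language) (l : logic L) : Prop :=
  exists D : set (form L),
    (forall d, D d -> Var d `<=` [set 0; 1]) /\
    forall (A : algebra L) (F : set A), model l F -> forall a b : A,
      leibniz F a b <-> (forall d, D d -> F (term2 d a b)).

Definition truth_equational (L : language) (l : logic L) : Prop :=
  exists tau : set (form L * form L),
    (forall e, tau e -> Var e.1 `<=` [set 0] /\ Var e.2 `<=` [set 0]) /\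
    forall (A : algebra L) (F : set A), reduced_model l F -> forall a : A,
      F a <-> (forall e, tau e -> eval (env1 a) e.1 = eval (env1 a) e.2).

Definition algebraizable (L : language) (l : logic L) : Prop :=
  equivalential l /\ truth_equational l.

(* In the last clause, b . a_1 . ... . a_n associates to the left. *)
Record partition_function (L : language) (A : algebra L) (dot : A -> A -> A) :
    Prop := PartitionFunction {
  pf_idem : forall a, dot a a = a;
  pf_assoc : forall a b c, dot a (dot b c) = dot (dot a b) c;
  pf_comm : forall a b c, dot a (dot b c) = dot a (dot c b);
  pf_opl : forall (g : symbol L) (a : 'I_(arity g) -> A) b, 0 < arity g ->
    dot (op a) b = op (fun i => dot (a i) b);
  pf_opr : forall (g : symbol L) (a : 'I_(arity g) -> A) b, 0 < arity g ->
    dot b (op a) = foldl dot b [seq a i | i <- enum 'I_(arity g)] }.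

Definition has_partition_function (L : language) (l : logic L) : Prop :=
  exists p : form L,
    [/\ Var p = [set 0; 1],
        l [set fvar 0] p &
        forall A : algebra L, Alg l A -> partition_function (@term2 L A p)].

(* Main.v *)
Require Import Defs.
From HB Require Import structures.
From Stdlib Require Import Relations.
From mathcomp Require Import all_boot.
From mathcomp Require Import boolp classical_sets functions cardinality.

(** For (i): if $x, \Delta(x,y) \vdash^l y$, then $y$ already follows from the
    members of $\Delta$ in which $x$ does not occur; these are theorems, being
    substitution instances of members of $\Delta(x,x)$, so $\vdash y$.

    For (ii): an equation valid in $\mathrm{Alg}(\vdash)$ whose two sides have
    the same variables holds in every reduced model $\langle A,F\rangle$ of
    $\vdash^l$. The partition function identities are of this kind, so $A$
    decomposes into fibres $A_e = \{a : a\cdot e = a, e\cdot a = e\}$. By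
    finitarity each $\langle A_e, F\cap A_e\rangle$ is a model of $\vdash$:
    multiplying a conclusion on the right by its premises adds their variables
    without changing its value. The relation
    "same fibre and $\Delta(a,b) \subseteq F$" is then a congruence of $A$
    compatible with $F$, hence the identity, so the fibres are reduced and the
    equations defining truth in $\mathrm{Mod}^*(\vdash)$ define truth in $A$. *)

Set Implicit Arguments.
Unset Strict Implicit.
Unset Printing Implicit Defensive.

Local Open Scope classical_set_scope.

HB.instance Definition _ (L : language) := gen_eqMixin (form L).
HB.instance Definition _ (L : language) := gen_choiceMixin (form L).

(** * Evaluation, substitution and iterated products under the term [p] *)

Section Evaluation.
Context {L : language}.
Implicit Types (A B : algebra L) (phi psi : form L).

Lemma eq_in_eval A (v w : nat -> A) phi :
  (forall n, Var phi n -> v n = w n) -> eval v phi = eval w phi.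
Proof.
elim: phi => [n|f args IH] /= vw; first exact: vw.
by congr op; apply/funext => i; apply: IH => n ni; apply: vw; exists i.
Qed.

Lemma eval_subst A (v : nat -> A) (s : nat -> form L) phi :
  eval v (subst s phi) = eval (fun n => eval v (s n)) phi.
Proof.
by elim: phi => [//|f args IH] /=; congr op; apply/funext => i; exact: IH.
Qed.

Lemma subst_fvar phi : subst fvar phi = phi.
Proof.
by elim: phi => [//|f args IH] /=; congr fapp; apply/funext => i; exact: IH.
Qed.

Lemma hom_eval A B (h : A -> B) (v : nat -> A) phi :
  is_hom h -> h (eval v phi) = eval (fun n => h (v n)) phi.
Proof.
move=> hh; elim: phi => [//|f args IH] /=.
by rewrite hh; congr op; apply/funext => i; exact: IH.
Qed.

Definition subst2 (p phi psi : form L) : form L := subst (env2 phi psi) p.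

Lemma eval_subst2 A (v : nat -> A) p phi psi :
  eval v (subst2 p phi psi) = term2 p (eval v phi) (eval v psi).
Proof. by rewrite eval_subst; congr eval; apply/funext => -[]. Qed.

Lemma Var_subst2 p phi psi :
  Var p = [set 0; 1] -> Var (subst2 p phi psi) = Var phi `|` Var psi.
Proof. by move=> Vp; rewrite Var_subst Vp bigcup_setU !bigcup_set1. Qed.

Lemma Var_foldl_subst2 p phi (s : seq (form L)) : Var p = [set 0; 1] ->
  Var (foldl (subst2 p) phi s) = Var phi `|` \bigcup_(g in [set` s]) Var g.
Proof.
move=> Vp; rewrite bigcup_seq; elim: s phi => [|g s IH] phi /=.
  by rewrite big_nil setU0.
by rewrite IH Var_subst2// big_cons setUA.
Qed.

Lemma eval_foldl_subst2 A (v : nat -> A) p phi (s : seq (form L)) :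
  eval v (foldl (subst2 p) phi s) =
  foldl (term2 p) (eval v phi) [seq eval v g | g <- s].
Proof. by elim: s phi => [//|g s IH] phi /=; rewrite IH eval_subst2. Qed.

End Evaluation.

(** * Generating pairs of the Leibniz congruence *)

Section LeibnizGeneration.
Context {L : language} (A : algebra L) (F : set A).

(** The transitive closure of [R] is a congruence, because arguments can be changed one at a time,
    and it inherits compatibility. This serves relations not known to be transitive. *)
Lemma leibniz_of_step (R : A -> A -> Prop) :
  (forall a, R a a) -> (forall a b, R a b -> R b a) -> compatible F R ->
  (forall (f : symbol L) (k : 'I_(arity f)) (a : 'I_(arity f) -> A) x y,
     R x y -> R (op (fun i => if i == k then x else a i))
                (op (fun i => if i == k then y else a i))) ->
  forall a b, R a b -> leibniz F a b.
Proof.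
move=> Rr Rs RF Rop a b Rab; exists (clos_trans A R); split; last exact: t_step.
- split.
  + by move=> x; apply: t_step.
  + move=> x y; elim=> [u w uw|u w z _ uw _ wz]; first by apply: t_step; exact: Rs.
    exact: t_trans wz uw.
  + by move=> x y z; exact: t_trans.
  + move=> f c d cd.
    have op1 k (e : 'I_(arity f) -> A) x y : clos_trans A R x y ->
        clos_trans A R (op (fun i => if i == k then x else e i))
                       (op (fun i => if i == k then y else e i)).
      elim=> [u w uw|u w z _ uw _ wz]; first by apply: t_step; exact: Rop.
      exact: t_trans uw wz.
    (* The first [m] arguments already come from [d], the others still from [c]. *)
    have step m : m <= arity f ->
        clos_trans A R (op c) (op (fun i => if i < m then d i else c i)).
      elim: m => [_|m IH mf]; first exact: t_step.
      apply: t_trans (IH (ltnW mf)) _.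
      have := op1 (Ordinal mf) (fun i => if i < m then d i else c i) _ _
        (cd (Ordinal mf)).
      congr clos_trans; congr op; apply/funext => i; rewrite -val_eqE /= ?ltnS.
        by case: ltngtP => // im; congr c; apply: val_inj.
      by case: ltngtP => // im; congr d; apply: val_inj.
    have := step _ (leqnn _); congr clos_trans; congr op.
    by apply/funext => i; rewrite ltn_ord.
- move=> x y; elim=> [u w uw|u w z _ uw _ wz]; first exact: RF.
  by move=> /uw; exact: wz.
Qed.

End LeibnizGeneration.

(** * Quotient of a matrix by its Leibniz congruence *)

Section Reduction.
Context {L : language} (l : logic L) (A : algebra L) (F : set A).

(** Elements are the classes themselves, as subsets of [A], so extensionality turns congruence into
    equality. *)
Let quotient : Type := {C : set A | exists a, C = leibniz F a}.

Let class (a : A) : quotient := exist _ (leibniz F a) (ex_intro _ a erefl).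

Let rep (C : quotient) : A := sval (cid (svalP C)).

Let class_eq a b : class a = class b <-> leibniz F a b.
Proof.
have [r s t _] := leibniz_congruence F.
split=> [[/(congr1 (@^~ b)) ->]|ab]; first exact: r.
apply/eq_exist/funext => c; apply/propext; split; last exact: t ab.
exact: t (s _ _ ab).
Qed.

Let repK C : class (rep C) = C.
Proof. by case: C => C hC; apply: eq_exist; rewrite /rep; case: cid => a /= ->. Qed.

Let leibniz_algebra : algebra L :=
  @Algebra L quotient
    (let: inhabits a := carrier_inhabited A in inhabits (class a))
    (fun f C => class (op (fun i => rep (C i)))).

Let class_hom : @is_hom L A leibniz_algebra class.
Proof.
move=> f a /=; apply/class_eq; apply: (cong_op (leibniz_congruence F)) => i.
by apply/class_eq; rewrite repK.
Qed.

(* The witness is the quotient by the Leibniz congruence. *)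
Lemma leibniz_reduction : model l F ->
  exists (B : algebra L) (G : set B) (q : A -> B),
    [/\ reduced_model l G, is_hom q, forall a, F a <-> G (q a) &
        forall a b, q a = q b <-> leibniz F a b].
Proof.
move=> mF; pose G : set leibniz_algebra := [set C | F (rep C)].
have FG a : F a <-> G (class a).
  have /class_eq ar : class (rep (class a)) = class a by rewrite repK.
  split; last exact: leibniz_compatible ar.
  by apply: leibniz_compatible; exact: cong_sym (leibniz_congruence F) _ _ ar.
exists leibniz_algebra, G, class; split=> //; split.
- move=> H phi Hphi v vH.
  have vE psi : eval v psi = class (eval (fun n => rep (v n)) psi).
    rewrite (hom_eval _ _ class_hom); congr eval; apply/funext => n.
    by rewrite repK.
  rewrite vE -FG; apply: (mF _ _ Hphi) => g Hg.
  by rewrite FG -vE; exact: vH.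
- move=> a b; split=> [[R [cR GR Rab]]|->]; last first.
    exact: cong_refl (leibniz_congruence G) b.
  rewrite -[a]repK -[b]repK; apply/class_eq.
  (* A compatible congruence on the quotient pulls back along [class] to one on [A], which lies
     inside [leibniz F]. *)
  exists (fun x y => R (class x) (class y)); split; last by rewrite !repK.
    have [r s t o] := cR; split=> [x|x y|x y z|g x y xy];
      [exact: r|exact: s|exact: t|].
    by rewrite !class_hom; exact: o.
  by move=> x y Rxy /FG Fx; apply/FG; exact: GR Rxy Fx.
Qed.

End Reduction.

(** [F] is one of the filters in the Suszko intersection, which is therefore below [leibniz F]. *)
Lemma reduced_model_Alg (L : language) (l : logic L) (A : algebra L) (F : set A) :
  reduced_model l F -> Alg l A.
Proof.
move=> [mF rF]; exists F; split=> // a b; split=> [ab|->].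
  by apply/rF; exact: ab.
by move=> H _ _; exact: cong_refl (leibniz_congruence H) b.
Qed.

(** * Equations valid in the algebras of the logic, and their transfer to the left companion *)

Definition Alg_valid (L : language) (l : logic L) (alpha beta : form L) : Prop :=
  forall A : algebra L, Alg l A -> forall v : nat -> A, eval v alpha = eval v beta.

Section AlgValid.
Context {L : language} (l : logic L).
Implicit Types alpha beta : form L.

Lemma Alg_valid_leibniz alpha beta (A : algebra L) (F : set A) (v : nat -> A) :
  Alg_valid l alpha beta -> model l F -> leibniz F (eval v alpha) (eval v beta).
Proof.
move=> ab mF; have [B [G [q [rG hq _ qE]]]] := leibniz_reduction mF.
by apply/qE; rewrite !hom_eval//; apply: ab; exact: reduced_model_Alg rG.
Qed.

Lemma theory_model (G : set (form L)) :
  @model L l (Fm L) [set phi | l G phi].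
Proof.
move=> H phi Hphi v Hv; apply: (entails_cut _ (entails_subst v Hphi)).
by move=> _ [g Hg <-]; exact: Hv.
Qed.

(** In the theory of [alpha], taken as a filter on the formulas, [beta] is Leibniz-congruent to the
    member [alpha]. *)
Lemma Alg_valid_entails alpha beta : Alg_valid l alpha beta -> l [set alpha] beta.
Proof.
move=> ab.
have := @Alg_valid_leibniz _ _ (Fm L) _ fvar ab (@theory_model [set alpha]).
rewrite -!/(subst _ _) !subst_fvar => /leibniz_compatible; apply.
exact: entails_refl.
Qed.

(** Equal variables make the rule from [s] to [t] valid in the left companion, so [R] below is
    compatible with [F]. Using [leibniz_of_step] avoids composing equations evaluated under
    different valuations. *)
Lemma regular_identity alpha beta (A : algebra L) (F : set A) (v : nat -> A) :
  reduced_model (left_companion l) F ->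
  Alg_valid l alpha beta -> Var alpha = Var beta -> eval v alpha = eval v beta.
Proof.
move=> [mF rF] ab Vab; apply/rF.
pose R (a b : A) := exists (w : nat -> A) s t, [/\ Alg_valid l s t, Var s = Var t,
  a = eval w s & b = eval w t].
apply: (@leibniz_of_step _ _ _ R); last by exists v, alpha, beta.
- by move=> a; exists (fun=> a), (fvar 0), (fvar 0).
- move=> _ _ [w [s [t [st Vst -> ->]]]]; exists w, t, s; split=> //.
  by move=> B AB u; rewrite st.
- move=> _ _ [w [s [t [st Vst -> ->]]]] Fs.
  apply: (mF [set s]); last by move=> _ ->.
  exists [set s]; split=> //; first by rewrite bigcup_set1 Vst.
  exact: Alg_valid_entails.
- move=> f k a _ _ [w [s [t [st Vst -> ->]]]].
  (* even variables carry w, odd variables the parameters a *)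
  pose w' n : A := if odd n then
    (if insub n./2 is Some i then a i else w 0) else w n./2.
  pose s' := subst (fun n => fvar n.*2) s; pose t' := subst (fun n => fvar n.*2) t.
  have Vst' : Var s' = Var t' by rewrite !Var_subst Vst.
  pose ctx x : form L :=
    fapp (fun i : 'I_(arity f) => if i == k then x else fvar i.*2.+1).
  have ctxE x y : eval w' (subst (fun n => fvar n.*2) x) = y ->
      op (fun i => if i == k then y else a i) =
      eval w' (ctx (subst (fun n => fvar n.*2) x)).
    move=> xy /=; congr op; apply/funext => i; case: eqP => // _ /=.
    by rewrite /w' /= odd_double /= uphalf_double valK.
  have w'E x : eval w' (subst (fun n => fvar n.*2) x) = eval w x.
    rewrite eval_subst; congr eval; apply/funext => n /=.
    by rewrite /w' odd_double doubleK.
  exists w', (ctx s'), (ctx t'); split; last 2 first.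
  + exact: ctxE.
  + exact: ctxE.
  + move=> B AB u /=; congr op; apply/funext => i; case: eqP => // _.
    by rewrite !eval_subst st.
  + by apply: eq_bigcupr => i _; case: eqP.
Qed.

End AlgValid.

(** * Partition function identities in reduced models of the left companion *)

Section PartitionTransfer.
Context {L : language} (l : logic L) (p : form L).
Hypothesis Vp : Var p = [set 0; 1].
Hypothesis pP : forall A : algebra L, Alg l A -> partition_function (@term2 L A p).

Lemma left_partition_function (A : algebra L) (F : set A) :
  reduced_model (left_companion l) F -> partition_function (@term2 L A p).
Proof.
move=> rF.
have idt s t (v : nat -> A) := @regular_identity _ l s t A F v rF.
pose P := subst2 p; pose x : form L := fvar 0; pose y : form L := fvar 1.
pose z : form L := fvar 2.
pose v3 (a b c : A) n := if n is n'.+1 then env2 b c n' else a.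
(* Variables below [arity g] carry the arguments; all others, in particular [arity g], carry [b]. *)
pose vf (g : symbol L) (a : 'I_(arity g) -> A) b n := if insub n is Some i then a i else b.
have vfE (g : symbol L) a b (i : 'I_(arity g)) : vf g a b i = a i by rewrite /vf valK.
have vfN (g : symbol L) a b : vf g a b (arity g) = b by rewrite /vf insubN// ltnn.
split.
- move=> a; have := idt (P x x) x (fun=> a); rewrite eval_subst2; apply.
    by move=> B AB v; rewrite eval_subst2 (pf_idem (pP AB)).
  by rewrite Var_subst2// setUid.
- move=> a b c; have := idt (P x (P y z)) (P (P x y) z) (v3 a b c).
  rewrite !eval_subst2; apply.
    by move=> B AB v; rewrite !eval_subst2 (pf_assoc (pP AB)).
  by rewrite !Var_subst2// setUA.
- move=> a b c; have := idt (P x (P y z)) (P x (P z y)) (v3 a b c).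
  rewrite !eval_subst2; apply.
    by move=> B AB v; rewrite !eval_subst2 (pf_comm (pP AB)).
  by rewrite !Var_subst2// [Var y `|` _]setUC.
- move=> g a b g0.
  pose t (i : 'I_(arity g)) := fvar i : form L; pose u := fvar (arity g) : form L.
  have := idt (P (fapp t) u) (fapp (fun i => P (t i) u)) (vf g a b).
  have -> : eval (vf g a b) (P (fapp t) u) = term2 p (op a) b.
    by rewrite eval_subst2 /= vfN; congr (term2 _ (op _) _); apply/funext.
  have -> : eval (vf g a b) (fapp (fun i => P (t i) u)) =
      op (fun i => term2 p (a i) b).
    transitivity (op (fun i => eval (vf g a b) (P (t i) u))) => //.
    by congr op; apply/funext => i; rewrite eval_subst2 /= vfN vfE.
  apply.
    move=> B AB v; rewrite eval_subst2 /= (pf_opl (pP AB))//.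
    by congr op; apply/funext => i; rewrite eval_subst2.
  (* Positive arity matters: with no arguments the right-hand side would lose the variable [u]. *)
  rewrite Var_subst2//= -bigcupUl; last by exists (Ordinal g0).
  by apply: eq_bigcupr => i _; exact: esym (Var_subst2 (t i) u Vp).
- move=> g a b g0.
  pose t (i : 'I_(arity g)) := fvar i : form L; pose u := fvar (arity g) : form L.
  have := idt (P u (fapp t)) (foldl P u [seq t i | i <- enum 'I_(arity g)])
    (vf g a b).
  have -> : eval (vf g a b) (P u (fapp t)) = term2 p b (op a).
    by rewrite eval_subst2 /= vfN; congr (term2 _ _ (op _)); apply/funext.
  rewrite eval_foldl_subst2 -map_comp /= vfN.
  have -> : eval (vf g a b) \o t = a by apply/funext => i; exact: vfE.
  apply.
    move=> B AB v; rewrite eval_subst2 eval_foldl_subst2 /= (pf_opr (pP AB))//.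
    by rewrite -map_comp.
  rewrite Var_subst2// Var_foldl_subst2//=; congr setU.
  apply/seteqP; split=> n [].
    by move=> i _ ni; exists (t i) => //=; apply: map_f; rewrite mem_enum.
  by move=> _ /= /mapP[i _ ->] ni; exists i.
Qed.

End PartitionTransfer.

(** * Fibres of a partition function *)

Section PartitionAlgebra.
Context {L : language} (no_constants : forall f : symbol L, 0 < arity f).
Context (A : algebra L) (dot : A -> A -> A) (pfA : partition_function dot).
Implicit Types a b c e : A.

Lemma pf_absorb a b : dot (dot a b) b = dot a b.
Proof. by rewrite -(pf_assoc pfA) (pf_idem pfA). Qed.

Lemma pf_eval (v : nat -> A) phi e :
  dot (eval v phi) e = eval (fun n => dot (v n) e) phi.
Proof.
elim: phi => [//|f args IH] /=.
by rewrite (pf_opl pfA)//; congr op; apply/funext => i; exact: IH.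
Qed.

Lemma pf_op_absorb (f : symbol L) (a : 'I_(arity f) -> A) e :
  (forall i, dot e (a i) = e) -> dot e (op a) = e.
Proof.
move=> ea; rewrite (pf_opr pfA)//.
by elim: (enum _) => //= i s; rewrite ea.
Qed.

(** By idempotence and [pf_opr], [op a] is [op a] times all the [a j]. Factors after the first
    commute, so a further [a i] meets its own copy and is absorbed. *)
Lemma pf_op_ge (f : symbol L) (a : 'I_(arity f) -> A) i :
  dot (op a) (a i) = op a.
Proof.
have comm b c d : dot (dot b c) d = dot (dot b d) c.
  by rewrite -!(pf_assoc pfA) (pf_comm pfA).
have foldC s b c : dot (foldl dot b s) c = foldl dot (dot b c) s.
  by elim: s b => //= d s IH b; rewrite IH comm.
have absorb s b : i \in s ->
    dot (foldl dot b [seq a j | j <- s]) (a i) = foldl dot b [seq a j | j <- s].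
  elim: s b => //= j s IH b; rewrite inE => /orP[/eqP <-|/IH //].
  by rewrite foldC pf_absorb.
have opE : op a = foldl dot (op a) [seq a j | j <- enum 'I_(arity f)].
  by rewrite -(pf_opr pfA)// (pf_idem pfA).
by rewrite opE absorb// mem_enum.
Qed.

(** The fibres of the Płonka decomposition: classes of the equivalence a·b = a, b·a = b. *)
Definition fibre e : set A := [set a | dot a e = a /\ dot e a = e].

Lemma fibre_refl e : fibre e e.
Proof. by split; exact: pf_idem. Qed.

Lemma fibre_op e (f : symbol L) (a : 'I_(arity f) -> A) :
  (forall i, fibre e (a i)) -> fibre e (op a).
Proof.
move=> ea; split; last by apply: pf_op_absorb => i; case: (ea i).
by rewrite (pf_opl pfA)//; congr op; apply/funext => i; case: (ea i).
Qed.

(** As a = a·e, associativity brings [b] next to [e], which absorbs it. *)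
Lemma fibre_dot e a b : fibre e a -> fibre e b -> dot a b = a.
Proof.
by move=> [ae _] [_ eb]; rewrite -ae -(pf_assoc pfA) eb.
Qed.

Lemma fibre_fibre e a b : fibre e a -> fibre e b -> fibre a b.
Proof. by move=> ea eb; split; [exact: fibre_dot eb ea|exact: fibre_dot ea eb]. Qed.

Lemma fibre_trans a b c : fibre a b -> fibre b c -> fibre a c.
Proof.
move=> [ba ab] [cb bc]; split; first by rewrite -cb -(pf_assoc pfA) ba.
by rewrite -ab -(pf_assoc pfA) bc.
Qed.

Definition fibre_algebra e : algebra L :=
  @Algebra L {a | fibre e a} (inhabits (exist _ e (fibre_refl e)))
    (fun f x => exist _ (op (fun i => sval (x i))) (fibre_op (fun i => svalP (x i)))).

Lemma fibre_eval e (v : nat -> fibre_algebra e) phi :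
  sval (eval v phi) = eval (fun n => sval (v n)) phi.
Proof. exact: (@hom_eval _ (fibre_algebra e) A sval). Qed.

End PartitionAlgebra.

(** * Failure of protoalgebraicity *)

Lemma left_companion_not_protoalgebraic (L : language) (l : logic L) :
  consistent l -> ~ protoalgebraic (left_companion l).
Proof.
move=> lC [D [_ Dxx [G [GD VG Gy]]]]; apply: lC => H phi.
have ly : l set0 (fvar 1).
  apply: entails_cut Gy => d Gd.
  have Vd n : Var d n -> n = 1 by move=> dn; apply: VG; exists d.
  (* The premise x itself is excluded, since only y may occur in [d]. *)
  have [d0|Dd] := GD _ Gd; first by have := Vd 0; rewrite d0 => /(_ erefl).
  have [E [E0 _ Ed]] := Dxx _ Dd.
  (* Replacing every variable by y turns d(x,x) back into [d], where only y occurs. *)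
  have := entails_subst (env1 (fvar 1)) Ed.
  have -> : subst (env1 (fvar 1)) @` E = set0.
    by move: E0; rewrite subset0 => ->; rewrite image_set0.
  congr (l _ _); rewrite -[RHS]subst_fvar [LHS](@eval_subst _ (Fm L)).
  by apply: (@eq_in_eval _ (Fm L)) => n /Vd ->.
have := entails_subst (env1 phi) ly; rewrite image_set0 /=.
by apply: entails_cut.
Qed.

(** * Fibres as models of the logic, and the Leibniz congruence across fibres *)

Section LeftTruth.
Context {L : language} (no_constants : forall f : symbol L, 0 < arity f).
Context (l : logic L) (p : form L).
Hypothesis l_finitary : finitary l.
Hypothesis Vp : Var p = [set 0; 1].
Hypothesis px : l [set fvar 0] p.
Context (A : algebra L) (F : set A).
Hypothesis mF : model (left_companion l) F.
Hypothesis pfA : partition_function (@term2 L A p).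

Local Notation "a ** b" := (term2 p a b) (at level 40, left associativity).
Local Notation fib := (fibre_algebra no_constants pfA).
Local Notation fibF e := ([set x | F (sval x)] : set (fib e)).

Lemma entails_subst2 phi psi : l [set phi] (subst2 p phi psi).
Proof. by have := entails_subst (env2 phi psi) px; rewrite image_set1. Qed.

Lemma entails_foldl_subst2 (G : set (form L)) phi s :
  l G phi -> l G (foldl (subst2 p) phi s).
Proof.
elim: s phi => [//|g s IH] phi Gphi /=; apply: IH.
by apply: entails_cut (entails_subst2 phi g) => _ ->.
Qed.

(** The rule from x to x·y survives in the left companion because x occurs in its conclusion. *)
Lemma filter_dot a b : F a -> F (a ** b).
Proof.
move=> Fa; apply: (@mF [set fvar 0] p _ (env2 a b)) => [|_ ->//].
exists [set fvar 0]; split=> //.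
by rewrite bigcup_set1 Vp => n /= ->; left.
Qed.

Lemma fibre_model e : model l (fibF e).
Proof.
move=> G phi Gphi v vG.
(* Finitarity leaves a finite list [s] of premises to multiply onto [phi]. *)
have [G' [G'G /finite_seqP[s G's] G'phi]] := l_finitary Gphi.
rewrite /= fibre_eval.
(* Within a fibre the product is the first projection, so the extra factors keep the value. *)
have <- : eval (fun n => sval (v n)) (foldl (subst2 p) phi s) =
    eval (fun n => sval (v n)) phi.
  rewrite eval_foldl_subst2; elim: s {G's} => //= g s IH.
  rewrite -!fibre_eval.
  rewrite (fibre_dot pfA (svalP _) (svalP _)).
  by rewrite fibre_eval.
apply: (@mF G'); last first.
  move=> g /G'G /vG /=.
  by rewrite fibre_eval.
exists G'; split=> //; last exact: entails_foldl_subst2.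
by rewrite Var_foldl_subst2// -G's; right.
Qed.

Context (D : set (form L)).
Hypothesis DP : forall (B : algebra L) (H : set B), model l H ->
  forall a b : B, leibniz H a b <-> (forall d, D d -> H (term2 d a b)).

(** Equivalentiality applies to the fibre, a model of [l]; being a subalgebra, it evaluates the
    formulas of [D] as [A] does. *)
Lemma fibre_leibnizP e (x y : fib e) :
  leibniz (fibF e) x y <-> (forall d, D d -> F (term2 d (sval x) (sval y))).
Proof.
rewrite (DP (@fibre_model e)).
have xyE d : sval (term2 d x y) = term2 d (sval x) (sval y).
  rewrite /term2 fibre_eval.
  by congr eval; apply/funext => -[].
by split=> xy d /xy /=; rewrite xyE.
Qed.

(** Right multiplication by [e] is an endomorphism; it carries the formulas of [D] from one fibre to
    another. *)
Lemma term2_dot d (a b e : A) : term2 d a b ** e = term2 d (a ** e) (b ** e).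
Proof.
by rewrite {2 3}/term2 (pf_eval no_constants pfA); congr eval; apply/funext => -[].
Qed.

(** On each fibre, [R] is the Leibniz congruence of that fibre, by [RE]. Only closure under
    operations needs more, since the arguments may lie in different fibres. *)
Lemma leibniz_of_fibre (a b : A) : fibre (@term2 L A p) a b ->
  (forall d, D d -> F (term2 d a b)) -> leibniz F a b.
Proof.
pose R (a b : A) := fibre (@term2 L A p) a b /\ forall d, D d -> F (term2 d a b).
have RE e (x y : fib e) c d : sval x = c -> sval y = d ->
    R c d <-> leibniz (fibF e) x y.
  move=> <- <-; split=> [[_ xy]|/fibre_leibnizP xy]; first exact/fibre_leibnizP.
  by split=> //; exact: (fibre_fibre pfA (svalP x) (svalP y)).
have lift e c : fibre (@term2 L A p) e c -> exists x : fib e, sval x = c.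
  by move=> ec; exists (exist _ c ec).
have Rrefl c : R c c.
  have [x xc] := lift _ _ (fibre_refl pfA c).
  by apply/(RE _ _ _ _ _ xc xc); exact: cong_refl (leibniz_congruence _) x.
move=> ab abF; exists R; split; last by split.
- split=> //.
  + move=> c d cd; have [x xc] := lift _ _ (fibre_refl pfA c).
    have [y yd] := lift _ _ cd.1; move: cd => /(RE _ _ _ _ _ xc yd) cd.
    apply/(RE _ _ _ _ _ yd xc).
    exact: cong_sym (leibniz_congruence _) _ _ cd.
  + move=> c d e cd de; have [x xc] := lift _ _ (fibre_refl pfA c).
    have [y yd] := lift _ _ cd.1.
    have [z ze] := lift _ _ (fibre_trans pfA cd.1 de.1).
    move: cd de => /(RE _ _ _ _ _ xc yd) cd /(RE _ _ _ _ _ yd ze) de.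
    apply/(RE _ _ _ _ _ xc ze).
    exact: cong_trans (leibniz_congruence _) _ _ _ cd de.
  (* Right multiplication by [e] brings all arguments into the single fibre of [e]. *)
  + move=> f c d cd; pose e := op c.
    have ec i : e ** c i = e by exact: pf_op_ge.
    have ed i : e ** d i = e.
      by rewrite -{1}(ec i) -(pf_assoc pfA) (cd i).1.2.
    have liftop c' : (forall i, e ** c' i = e) ->
        exists x : 'I_(arity f) -> fib e, forall i, sval (x i) = c' i ** e.
      move=> ec'; have /choice[x xc] : forall i, exists x : fib e, sval x = c' i ** e.
        move=> i; apply: lift; split; first exact: pf_absorb.
        by rewrite (pf_assoc pfA) ec' (pf_idem pfA).
      by exists x.
    have [x xc] := liftop _ ec; have [y yd] := liftop _ ed.
    (* [F] is closed under right multiplication, so it keeps the values of [D] after the move. *)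
    have xyF i : leibniz (fibF e) (x i) (y i).
      apply/fibre_leibnizP => g Dg; rewrite xc yd -term2_dot.
      by apply: filter_dot; exact: (cd i).2.
    have opE c' z : (forall i, sval (z i : fib e) = c' i ** e) ->
        sval (@op L (fib e) f z) = op c' ** e.
      by move=> zc /=; rewrite (pf_opl pfA)//; congr op; apply/funext.
    have := cong_op (leibniz_congruence (fibF e)) xyF.
    move=> /(RE _ _ _ _ _ (opE _ _ xc) (opE _ _ yd)); rewrite (pf_idem pfA).
    (* [op d] absorbs each [d i], hence each [c i], hence [e], which is [op c]. *)
    suff -> : op d ** e = op d by [].
    apply: pf_op_absorb => // i; rewrite -(pf_op_ge no_constants pfA d i).
    by rewrite -(pf_assoc pfA) (cd i).1.1.
- move=> c d cd; have [x xc] := lift _ _ (fibre_refl pfA c).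
  have [y yd] := lift _ _ cd.1; move: cd => /(RE _ _ _ _ _ xc yd).
  by move=> /leibniz_compatible; rewrite /= xc yd.
Qed.

End LeftTruth.

(** In the reduced quotient [tau] defines truth, and equality there pulls back to Leibniz
    congruence. *)
Lemma truth_equational_leibniz (L : language) (l : logic L)
    (tau : set (form L * form L)) (A : algebra L) (F : set A) (a : A) :
  (forall (B : algebra L) (G : set B), reduced_model l G -> forall b : B,
     G b <-> forall e, tau e -> eval (env1 b) e.1 = eval (env1 b) e.2) ->
  model l F ->
  F a <-> forall e, tau e -> leibniz F (eval (env1 a) e.1) (eval (env1 a) e.2).
Proof.
move=> tauP mF; have [B [G [q [rG hq FG qE]]]] := leibniz_reduction mF.
rewrite FG (tauP _ _ rG); split=> E e /E; last first.
  by move=> /qE; rewrite !(hom_eval _ _ hq).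
by move=> ee; apply/qE; rewrite !(hom_eval _ _ hq).
Qed.

Theorem theorem6p1 (L : language)
    (no_constants : forall f : symbol L, 0 < arity f) (l : logic L) :
  (consistent l -> ~ protoalgebraic (left_companion l)) /\
  (finitary l -> algebraizable l -> has_partition_function l ->
     truth_equational (left_companion l)).
Proof.
split; first exact: left_companion_not_protoalgebraic.
move=> l_fin [[D [_ DP]] [tau [Vtau tauP]]] [p [Vp px pP]].
(* The same equations work: membership of [a] is tested inside its own fibre. *)
exists tau; split=> // A F rF a; have [mF eqF] := rF.
have pfA := left_partition_function Vp pP rF.
have mFa := @fibre_model _ no_constants _ _ l_fin Vp px A F mF pfA a.
pose a' : fibre_algebra no_constants pfA a := exist _ a (fibre_refl pfA a).
have a'E phi : sval (eval (env1 a') phi) = eval (env1 a) phi by rewrite fibre_eval.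
have := truth_equational_leibniz a' tauP mFa.
rewrite /= => ->; split=> E e /E; last first.
  rewrite -!a'E => ee.
  have -> : eval (env1 a') e.1 = eval (env1 a') e.2.
    by move: ee; do 2!case: (eval _ _) => ? ?; exact: eq_exist.
  exact: cong_refl (leibniz_congruence _) _.
(* Congruence in the fibre puts the values of [D] in [F]; this gives Leibniz congruence in [A],
   which is equality by reducedness. *)
move=> /(fibre_leibnizP l_fin Vp px mF DP); rewrite !a'E => ee.
apply/eqF; apply: (leibniz_of_fibre no_constants l_fin Vp px mF pfA DP) ee.
rewrite -!a'E; exact: (fibre_fibre pfA (svalP (eval (env1 a') e.1)) (svalP _)).
Qed.
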